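(* Let $C=2$ (binary classification), let $F_0:\mathbb{R}^d\to[C]$ be a base classifier, let $\mathbf{x}_0\in\mathbb{R}^d$ have true label $y_0\in[C]$, and let $\mathcal P$ be a smoothing distribution on $\mathbb{R}^d$ whose density satisfies $p(\mathbf{x})>0$ for all $\mathbf{x}\in\mathbb{R}^d$. Let $c\in[C]$ be an arbitrary class and let $\mathcal Q$ be a distribution on $\mathbb{R}^d$ with density $q$ such that: (1) $\mathrm{supp}(\mathcal Q)=\{\mathbf{x}-\mathbf{x}_0:\ F_0(\mathbf{x})=c\}$; (2) for every $\mathbf{x}\in\mathrm{supp}(\mathcal Q)$, $0<q(\mathbf{x})/p(\mathbf{x})<+\infty$. Put $P_A=f_{F_0}^{\mathcal P}(\mathbf{x}_0)_c$ and $Q_A=f_{F_0}^{\mathcal Q}(\mathbf{x}_0)_c$. Then for every $\ell_{p}$ norm with $p\ge 1$, $$r_{\mathsf{DSRS}}=r_{\mathsf{tight}}.$$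
   Context: $[C]=\{1,\dots,C\}$. A classifier is a (measurable) map $F:\mathbb{R}^d\to[C]$. For a probability distribution $\mathcal D$ on $\mathbb{R}^d$, $f_F^{\mathcal D}(\mathbf{x})_{c}:=\Pr_{\boldsymbol\varepsilon\sim\mathcal D}[F(\mathbf{x}+\boldsymbol\varepsilon)=c]$. The smoothed classifier is $\widetilde F^{\mathcal P}(\mathbf{x}):=\arg\max_{c\in[C]} f_F^{\mathcal P}(\mathbf{x})_c$ (ties broken by a fixed rule depending only on the vector $f_F^{\mathcal P}(\mathbf{x})$). Here $\mathrm{supp}(\mathcal Q)$ denotes the set where the density $q$ is positive. For a norm $\|\cdot\|_p$ on $\mathbb{R}^d$ (the letter $p$ in $\ell_p$ is the norm exponent, not the density): $r_{\mathsf{tight}}$ is the largest $r\in[0,\infty]$ such that $\widetilde F_0^{\mathcal P}(\mathbf{x}_0+\boldsymbol\delta)=y_0$ for all $\boldsymbol\delta\in\mathbb{R}^d$ with $\|\boldsymbol\delta\|_p<r$. $r_{\mathsf{DSRS}}$ (determined by $\mathcal P,\mathcal Q,P_A,Q_A$) is the largest $r\in[0,\infty]$ such that for every classifier $F:\mathbb{R}^d\to[C]$ with $f_F^{\mathcal P}(\mathbf{x}_0)_{c}=P_A$ and $f_F^{\mathcal Q}(\mathbf{x}_0)_{c}=Q_A$ one has $\widetilde F^{\mathcal P}(\mathbf{x})=y_0$ for all $\mathbf{x}$ with $\|\mathbf{x}-\mathbf{x}_0\|_p<r$. *)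

(* Defs.v *)
From HB Require Import structures.
From mathcomp Require Import all_boot all_order all_algebra.
From mathcomp Require Import all_classical all_reals all_analysis.

Set Implicit Arguments.
Unset Strict Implicit.
Unset Printing Implicit Defensive.

Import Order.TTheory GRing.Theory Num.Theory.
Import numFieldNormedType.Exports.

Local Open Scope classical_set_scope.
Local Open Scope ring_scope.

(* Row vectors carry the sigma-algebra generated by the coordinate maps; for
   R : realType this is the Borel sigma-algebra of R^n. *)
Section measurable_row_vector.
Context {disp : measure_display} {T : sigmaRingType disp}.
Variable n : nat.

Let coord : 'I_n -> 'rV[T]_n -> T := fun i x => x ord0 i.

Let rV_set0 : g_sigma_preimage coord set0.
Proof. exact: sigma_algebra0. Qed.

Let rV_setC A : g_sigma_preimage coord A -> g_sigma_preimage coord (~` A).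
Proof. exact: sigma_algebraC. Qed.

Let rV_bigcup (F : (set 'rV[T]_n)^nat) :
  (forall i, g_sigma_preimage coord (F i)) ->
  g_sigma_preimage coord (\bigcup_i F i).
Proof. exact: sigma_algebra_bigcup. Qed.

HB.instance Definition _ := @isMeasurable.Build (measure_tuple_display disp)
  'rV[T]_n (g_sigma_preimage coord) rV_set0 rV_setC rV_bigcup.

End measurable_row_vector.

Section measurable_row_vector_theory.
Context {R : realType}.

Lemma measurable_rV_coord n (i : 'I_n) :
  measurable_fun [set: 'rV[R]_n] (fun x : 'rV[R]_n => x ord0 i).
Proof.
move=> _ Y mY; rewrite setTI; apply: sub_sigma_algebra => /=.
rewrite -bigcup_seq/=; exists i => /=; first by rewrite mem_index_enum.
by exists Y => //; rewrite setTI.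
Qed.

Lemma measurable_fun_rVP disp (T : measurableType disp) n (f : T -> 'rV[R]_n) :
  measurable_fun [set: T] f <->
  forall i, measurable_fun [set: T] (fun t => f t ord0 i).
Proof.
split=> [mf i|mf].
  exact: (measurableT_comp (measurable_rV_coord i) mf).
have P : measurable `<=` [set A : set 'rV[R]_n | measurable (f @^-1` A)].
  apply: smallest_sub.
    split => /=.
    - by rewrite preimage_set0.
    - by move=> A mA; rewrite setTD preimage_setC; exact: measurableC.
    - by move=> F mF; rewrite preimage_bigcup; exact: bigcup_measurable.
  rewrite -bigcup_seq; apply: bigcup_sub => i _ A [B mB <-]/=.
  rewrite setTI -comp_preimage.
  by have := mf i measurableT B mB; rewrite setTI.
by move=> _ Y mY; rewrite setTI; exact: P.
Qed.

Definition rV_cons n (z : R * 'rV[R]_n) : 'rV[R]_n.+1 :=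
  \row_i if unlift ord0 i is Some j then z.2 ord0 j else z.1.

Lemma rV_cons0 n (z : R * 'rV[R]_n) : rV_cons z ord0 ord0 = z.1.
Proof. by rewrite mxE unlift_none. Qed.

Lemma rV_consS n (z : R * 'rV[R]_n) (i : 'I_n) :
  rV_cons z ord0 (lift ord0 i) = z.2 ord0 i.
Proof. by rewrite mxE liftK. Qed.

Lemma measurable_rV_cons n : measurable_fun [set: R * 'rV[R]_n] (@rV_cons n).
Proof.
apply/measurable_fun_rVP => i.
have [j ->|->] := unliftP ord0 i.
- under eq_fun do rewrite rV_consS.
  exact: (measurableT_comp (measurable_rV_coord j) measurable_snd).
- under eq_fun do rewrite rV_cons0.
  exact: measurable_fst.
Qed.

Definition rV_uncons n (x : 'rV[R]_n.+1) : R * 'rV[R]_n :=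
  (x ord0 ord0, \row_i x ord0 (lift ord0 i)).

Lemma rV_consK n : cancel (@rV_cons n) (@rV_uncons n).
Proof.
move=> z; rewrite /rV_uncons rV_cons0 [RHS]surjective_pairing; congr pair.
by apply/rowP => i; rewrite mxE rV_consS.
Qed.

Lemma measurable_rV_uncons n : measurable_fun [set: 'rV[R]_n.+1] (@rV_uncons n).
Proof.
apply: measurable_fun_pair; first exact: measurable_rV_coord.
apply/measurable_fun_rVP => i.
by under eq_fun do rewrite mxE; exact: measurable_rV_coord.
Qed.

End measurable_row_vector_theory.

Section lebesgue_measure_rV.
Context {R : realType}.
Local Open Scope ereal_scope.

Section step.
Variables (n : nat) (mu : {sigma_finite_measure set 'rV[R]_n -> \bar R}).

Definition lebesgue_rV_step : set 'rV[R]_n.+1 -> \bar R :=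
  pushforward (lebesgue_measure \x mu) (@rV_cons R n).

HB.instance Definition _ := Measure.copy lebesgue_rV_step
  (measure_function_pushforward__canonical__measure_function_Measure
     (lebesgue_measure \x mu : measure (measurableTypeR R * 'rV[R]_n)%type R)
     (@measurable_rV_cons R n)).

Let sigma_finite_step : sigma_finite setT lebesgue_rV_step.
Proof.
have /sigma_finiteP[F [TF ndF Foo]] := sigma_finiteT (@lebesgue_measure R).
have /sigma_finiteP[G [TG ndG Goo]] := sigma_finiteT mu.
exists (fun k => @rV_uncons R n @^-1` (F k `*` G k)).
  rewrite -preimage_bigcup -(preimage_setT (@rV_uncons R n)); congr preimage.
  rewrite -setXTT TF TG predeqE => -[x y]; split.
    move=> [/= [k _ Fkx] [l _ Gly]]; exists (maxn k l) => //; split.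
    - by move: x Fkx; exact/subsetPset/ndF/leq_maxl.
    - by move: y Gly; exact/subsetPset/ndG/leq_maxr.
  by move=> [k _ []/= ? ?]; split; exists k.
move=> k; have [mF Fkoo] := Foo k; have [mG Gkoo] := Goo k; split.
  rewrite -[X in measurable X]setTI; apply: measurable_rV_uncons => //.
  exact: measurableX.
rewrite /lebesgue_rV_step /pushforward -comp_preimage.
rewrite (_ : _ \o _ = id); last by apply/funext => z /=; rewrite rV_consK.
by rewrite preimage_id product_measure1E// lte_mul_pinfty// ge0_fin_numE.
Qed.

HB.instance Definition _ := @Measure_isSigmaFinite.Build _ _ _
  lebesgue_rV_step sigma_finite_step.

End step.

(* The n-fold product of the Lebesgue measure on R, along the isomorphisms
   R * R^n ~ R^n.+1; on R^0 it is the unit mass. *)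
Fixpoint lebesgue_rV (n : nat) : {sigma_finite_measure set 'rV[R]_n -> \bar R} :=
  match n with
  | 0 => \d_(0%R : 'rV[R]_0)
  | m.+1 => lebesgue_rV_step (lebesgue_rV m)
  end.

Lemma lebesgue_rV_box n (a b : 'rV[R]_n) :
  (forall i, (a ord0 i <= b ord0 i)%R) ->
  lebesgue_rV n [set x | forall i, (a ord0 i < x ord0 i <= b ord0 i)%R] =
  (\prod_i (b ord0 i - a ord0 i))%:E.
Proof.
elim: n a b => [|n IH] a b ab.
  by rewrite big_ord0 /= diracE mem_set// => -[].
pose I : set R := `]a ord0 ord0, b ord0 ord0]%classic.
pose a' := (rV_uncons a).2; pose b' := (rV_uncons b).2.
pose B := [set x : 'rV[R]_n | forall i, (a' ord0 i < x ord0 i <= b' ord0 i)%R].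
have mB : measurable B.
  rewrite (_ : B = \bigcap_(i in [set: 'I_n])
      ((fun x : 'rV[R]_n => x ord0 i) @^-1` `]a' ord0 i, b' ord0 i]%classic)).
    apply: fin_bigcap_measurable => // i _.
    rewrite -[X in measurable X]setTI; apply: measurable_rV_coord => //.
  apply/seteqP; split=> x /=.
    by move=> H i _ /=; rewrite in_itv/=; exact: H.
  by move=> H i; have := H i Logic.I; rewrite /= in_itv.
rewrite /= /lebesgue_rV_step /pushforward (_ : _ @^-1` _ = I `*` B); last first.
  apply/seteqP; split=> -[x v] /=.
    move=> H; split.
      by have := H ord0; rewrite rV_cons0 /= /I /= in_itv.
    by move=> i; have := H (lift ord0 i); rewrite rV_consS !mxE.
  move=> -[+ H] i; rewrite /I /= in_itv/= => Hx.
  have [j ->|->] := unliftP ord0 i; last by rewrite rV_cons0.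
  by have := H j; rewrite rV_consS !mxE.
have II : lebesgue_measure I = (b ord0 ord0 - a ord0 ord0)%:E.
  rewrite lebesgue_measure_itv/= lte_fin.
  have := ab ord0; rewrite le_eqVlt => /predU1P[->|->]; last by rewrite EFinB.
  by rewrite ltxx subrr.
rewrite product_measure1E//; last exact: measurable_itv.
rewrite IH; last by move=> i; rewrite !mxE.
rewrite big_ord_recl EFinM; congr (_ * _); first exact: II.
by congr EFin; apply: eq_bigr => i _; rewrite !mxE.
Qed.

End lebesgue_measure_rV.

Section smoothing.
Context {R : realType}.

(* Only exponents r >= 1 are meant; the value at r = -oo is irrelevant. *)
Definition lp_norm d (r : \bar R) (x : 'rV[R]_d) : R :=
  match r with
  | r'%:E => (\sum_i `|x ord0 i| `^ r') `^ r'^-1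
  | +oo%E => \big[Num.max/0]_i `|x ord0 i|
  | -oo%E => 0
  end.

Definition has_density d (D : probability 'rV[R]_d R) (f : 'rV[R]_d -> R) :=
  [/\ measurable_fun [set: 'rV[R]_d] f, (forall x, 0 <= f x) &
      forall A, measurable A -> D A = (\int[lebesgue_rV d]_(x in A) (f x)%:E)%E].

Definition density_support d (f : 'rV[R]_d -> R) : set 'rV[R]_d :=
  [set x | 0 < f x].

Definition classifier d C (F : 'rV[R]_d -> 'I_C) :=
  forall c, measurable [set x | F x = c].

Definition class_prob d C (D : probability 'rV[R]_d R) (F : 'rV[R]_d -> 'I_C)
    (x : 'rV[R]_d) : 'rV[R]_C :=
  \row_c fine (D [set e | F (x + e) = c]).

(* [am] is the argmax function with its tie-breaking rule built in: the class
   chosen depends on the vector only and attains the maximum. *)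
Definition argmax_rule C (am : 'rV[R]_C -> 'I_C) :=
  forall (v : 'rV[R]_C) c, v ord0 c <= v ord0 (am v).

Definition smoothed d C (am : 'rV[R]_C -> 'I_C) (D : probability 'rV[R]_d R)
    (F : 'rV[R]_d -> 'I_C) (x : 'rV[R]_d) : 'I_C :=
  am (class_prob D F x).

Definition tight_radii d C (p : \bar R) (am : 'rV[R]_C -> 'I_C)
    (P : probability 'rV[R]_d R) (F0 : 'rV[R]_d -> 'I_C)
    (x0 : 'rV[R]_d) (y0 : 'I_C) : set (\bar R) :=
  [set r | (0 <= r)%E /\ forall delta : 'rV[R]_d,
    ((lp_norm p delta)%:E < r)%E -> smoothed am P F0 (x0 + delta) = y0].

(* The supremum is attained, see r_tight_max. *)
Definition r_tight d C (p : \bar R) (am : 'rV[R]_C -> 'I_C)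
    (P : probability 'rV[R]_d R) (F0 : 'rV[R]_d -> 'I_C)
    (x0 : 'rV[R]_d) (y0 : 'I_C) : \bar R :=
  ereal_sup (tight_radii p am P F0 x0 y0).

Definition dsrs_radii d C (p : \bar R) (am : 'rV[R]_C -> 'I_C)
    (P Q : probability 'rV[R]_d R) (x0 : 'rV[R]_d) (y0 c : 'I_C)
    (PA QA : R) : set (\bar R) :=
  [set r | (0 <= r)%E /\ forall F : 'rV[R]_d -> 'I_C, classifier F ->
    class_prob P F x0 ord0 c = PA -> class_prob Q F x0 ord0 c = QA ->
    forall x : 'rV[R]_d, ((lp_norm p (x - x0)%R)%:E < r)%E ->
      smoothed am P F x = y0].

(* The supremum is attained, see r_dsrs_max. *)
Definition r_dsrs d C (p : \bar R) (am : 'rV[R]_C -> 'I_C)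
    (P Q : probability 'rV[R]_d R) (x0 : 'rV[R]_d) (y0 c : 'I_C)
    (PA QA : R) : \bar R :=
  ereal_sup (dsrs_radii p am P Q x0 y0 c PA QA).

Lemma lp_norm_ge0 d (r : \bar R) (x : 'rV[R]_d) : 0 <= lp_norm r x.
Proof.
case: r => [r| |] //=; first exact: powR_ge0.
by elim/big_ind : _ => // u v u0 v0; rewrite le_max u0.
Qed.

Lemma r_tight_max d C (p : \bar R) (am : 'rV[R]_C -> 'I_C)
    (P : probability 'rV[R]_d R) (F0 : 'rV[R]_d -> 'I_C)
    (x0 : 'rV[R]_d) (y0 : 'I_C) (S := tight_radii p am P F0 x0 y0) :
  S (r_tight p am P F0 x0 y0) /\
  forall r, S r -> (r <= r_tight p am P F0 x0 y0)%E.
Proof.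
split; last by move=> r Sr; exact: ereal_sup_ubound.
split.
  apply: ereal_sup_ubound; split=> // delta.
  by rewrite lte_fin ltNge lp_norm_ge0.
by move=> delta /ereal_sup_gt [r [_ +] rd]; exact.
Qed.

Lemma r_dsrs_max d C (p : \bar R) (am : 'rV[R]_C -> 'I_C)
    (P Q : probability 'rV[R]_d R) (x0 : 'rV[R]_d) (y0 c : 'I_C)
    (PA QA : R) (S := dsrs_radii p am P Q x0 y0 c PA QA) :
  S (r_dsrs p am P Q x0 y0 c PA QA) /\
  forall r, S r -> (r <= r_dsrs p am P Q x0 y0 c PA QA)%E.
Proof.
split; last by move=> r Sr; exact: ereal_sup_ubound.
split.
  apply: ereal_sup_ubound; split=> // F _ _ _ x.
  by rewrite lte_fin ltNge lp_norm_ge0.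
by move=> F mF FP FQ x /ereal_sup_gt [r [_ +] rd]; exact.
Qed.

End smoothing.

(* Main.v *)
(* The class-c region T of a competing classifier F around x0 has the same P-
   and Q-mass as that of F0, which is S = supp Q. No Q-mass lies outside S, so
   Q (S \ T) = 0, and S \ T is Lebesgue-null because q > 0 on S; then
   P (T \ S) = P (S \ T) = 0, and T \ S is null because p > 0. As C = 2, F and
   F0 agree almost everywhere, and by translation invariance of Lebesgue measure
   they have the same class probabilities at every point. As F0 itself is a
   competitor, the two radii coincide. *)

Require Import Defs.
From HB Require Import structures.
From mathcomp Require Import all_boot all_order all_algebra.
From mathcomp Require Import all_classical all_reals all_analysis.
From mathcomp Require Import measurable_realfun.

Set Implicit Arguments.
Unset Strict Implicit.
Unset Printing Implicit Defensive.

Import Order.TTheory GRing.Theory Num.Theory.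
Import numFieldNormedType.Exports.

Local Open Scope classical_set_scope.
Local Open Scope ring_scope.

Section translation_invariance.
Context {R : realType}.
Local Open Scope ereal_scope.

Lemma measurable_rV_shift n (v : 'rV[R]_n) :
  measurable_fun [set: 'rV[R]_n] (fun x => v + x)%R.
Proof.
apply/measurable_fun_rVP => i; under eq_fun do rewrite mxE.
by apply: measurable_funD => //; exact: measurable_rV_coord.
Qed.

Lemma measurable_preimage_rV_shift n (v : 'rV[R]_n) (A : set 'rV[R]_n) :
  measurable A -> measurable [set x | A (v + x)%R].
Proof.
by move=> mA; rewrite -[X in measurable X]setTI; exact: measurable_rV_shift.
Qed.

(** Lebesgue measure is determined by its values on half-open intervals, and the shift pulls []b,
    c]] back to []b - a, c - a]], of the same length. *)
Lemma lebesgue_measure_shift (a : R) (A : set (measurableTypeR R)) :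
  measurable A -> pushforward (@lebesgue_measure R)
    (fun x => a + x : measurableTypeR R)%R A = lebesgue_measure A.
Proof.
move=> mA; apply/esym/lebesgue_measure_unique => //=.
  exact: measurable_funD.
move=> ma _ [[b c]] _ <-.
rewrite /pushforward (_ : _ @^-1` _ = `](b - a), (c - a)]%classic)%R.
  rewrite !lebesgue_measure_itv/= !lte_fin ltrD2r.
  by case: ifP => // _; rewrite -!EFinB opprB addrA subrK.
by apply/seteqP; split=> x /=; rewrite !in_itv/= ltrBlDl lerBrDl.
Qed.

(** Induction on the dimension: the product measure integrates the measures of sections over the
    first coordinate, so the shift splits into [a] on that coordinate and [w] on the sections. *)
Lemma lebesgue_rV_shift n (v : 'rV[R]_n) (A : set 'rV[R]_n) :
  measurable A -> lebesgue_rV n [set x | A (v + x)%R] = lebesgue_rV n A.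
Proof.
elim: n v A => [|n IH] v A mA.
  congr (lebesgue_rV 0 _); apply/seteqP; split=> x /=;
    by rewrite [(v + x)%R]thinmx0 [x]thinmx0.
pose B := @rV_cons R n @^-1` A.
have mB : measurable B.
  by rewrite -[X in measurable X]setTI; exact: measurable_rV_cons.
pose a := v ord0 ord0; pose w : 'rV[R]_n := (\row_i v ord0 (lift ord0 i))%R.
have vE z : (v + rV_cons z = rV_cons (a + z.1, w + z.2))%R.
  apply/rowP => i; rewrite mxE.
  by have [j ->|->] := unliftP ord0 i; rewrite ?rV_consS ?rV_cons0// !mxE.
rewrite /= /lebesgue_rV_step /pushforward -/B.
(* The section of the shifted set at [x] is the section of [B] at [a + x], shifted by [w]; the
   induction hypothesis removes [w]. *)
transitivity (\int[lebesgue_measure]_x (lebesgue_rV n (xsection B (a + x)%R))).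
  apply: eq_integral => x _ /=.
  rewrite -[RHS](IH w); last exact: measurable_xsection.
  by congr (lebesgue_rV n _); apply/seteqP; split=> y /=;
    rewrite !xsectionE /B/= vE.
(* A change of variables moves [a] into the measure, where the one-dimensional case absorbs it. *)
transitivity (\int[pushforward (@lebesgue_measure R)
    (fun x => a + x : measurableTypeR R)%R]_x (lebesgue_rV n (xsection B x))).
  rewrite ge0_integral_pushforward//.
  - exact: measurable_funD.
  - exact: measurable_fun_xsection.
by apply: eq_measure_integral => [|ma E mE _]; [exact: measurable_funD|
  exact: lebesgue_measure_shift].
Qed.

End translation_invariance.

Section density.
Context {R : realType} (d : nat).
Local Open Scope ereal_scope.
Implicit Types (D : probability 'rV[R]_d R) (f : 'rV[R]_d -> R).

Lemma has_density_null D f (A : set 'rV[R]_d) : has_density D f ->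
  measurable A -> lebesgue_rV d A = 0 -> D A = 0.
Proof.
move=> [mf _ fE] mA A0; rewrite fE// null_set_integral//.
by apply/measurable_EFinP; exact: measurable_funS mf.
Qed.

(** A nonnegative function with zero integral on [A] vanishes almost everywhere there; as [f]
    vanishes nowhere on [A], the exceptional set is all of [A]. *)
Lemma lebesgue_null_of_density D f (A : set 'rV[R]_d) : has_density D f ->
  measurable A -> A `<=` density_support f -> D A = 0 -> lebesgue_rV d A = 0.
Proof.
move=> [mf f0 fE] mA Af; rewrite fE// => int0.
have mfA : measurable_fun A (EFin \o f).
  by apply/measurable_EFinP; exact: measurable_funS mf.
have : \int[lebesgue_rV d]_(x in A) `|(EFin \o f) x| = 0.
  rewrite -[RHS]int0; apply: eq_integral => x _.
  by rewrite /= ger0_norm.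
move/(ae_eq_integral_abs _ mA mfA) => fA0.
apply: measure_negligible => //.
apply: negligibleS fA0 => x Ax /= /(_ Ax) [] fx0.
by have := Af _ Ax; rewrite /density_support/= fx0 ltxx.
Qed.

Lemma has_density_supp0 D f (A : set 'rV[R]_d) : has_density D f ->
  measurable A -> density_support f `&` A = set0 -> D A = 0.
Proof.
move=> [_ f0 fE] mA fA; rewrite fE// integral0_eq// => x Ax; congr EFin.
apply/eqP; rewrite eq_le f0 andbT leNgt; apply/negP => fx.
by have : (density_support f `&` A) x by []; rewrite fA.
Qed.

End density.

Lemma density_support_determined (R : realType) (d : nat)
    (P Q : probability 'rV[R]_d R) (p q : 'rV[R]_d -> R) (T : set 'rV[R]_d) :
  has_density P p -> (forall x, 0 < p x) -> has_density Q q ->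
  measurable (density_support q) -> measurable T ->
  P T = P (density_support q) -> Q T = Q (density_support q) ->
  lebesgue_rV d (T `+` density_support q) = 0%E.
Proof.
move=> Pp p0 Qq; set S := density_support q => mS mT PT QT.
have mST : measurable (S `\` T) by exact: measurableD.
have mTS : measurable (T `\` S) by exact: measurableD.
have DI (D : probability 'rV[R]_d R) A B : measurable A -> measurable B ->
    D A = (D (A `\` B) + D (A `&` B))%E by exact: measureDI.
have finD (D : probability 'rV[R]_d R) A : measurable A -> D A \is a fin_num.
  by move=> mA; exact: fin_num_measure.
(* Used with [y] the mass of the intersection of [S] and [T], finite because the measures are
   probabilities. *)
have cancel0 (x y : \bar R) : y \is a fin_num -> (y = x + y)%E -> x = 0%E.
  by move=> fy yE; rewrite -(addeK x fy) -yE subee.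
have ST0 : lebesgue_rV d (S `\` T) = 0%E.
  apply: (lebesgue_null_of_density Qq) => //.
  have QTS : Q (T `\` S) = 0%E.
    by apply: (has_density_supp0 Qq) => //; rewrite setIC -setIA setICl setI0.
  have QS := DI Q _ _ mS mT; have := DI Q _ _ mT mS.
  rewrite QTS add0e QT setIC QS => /esym.
  by apply: cancel0; apply: finD; exact: measurableI.
have TS0 : lebesgue_rV d (T `\` S) = 0%E.
  apply: (lebesgue_null_of_density Pp) => //.
    by move=> x _; exact: p0.
  (* Nullity obtained through [Q] passes to [P] because [P] has a density. *)
  have PST : P (S `\` T) = 0%E by exact: has_density_null Pp _ _.
  have PS := DI P _ _ mS mT; have := DI P _ _ mT mS.
  rewrite PT PS PST add0e setIC.
  by apply: cancel0; apply: finD; exact: measurableI.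
by rewrite /setY measureU0//; exact: ST0.
Qed.

Theorem theorem1 (R : realType) (d : nat)
    (am : 'rV[R]_2 -> 'I_2) (am_argmax : argmax_rule am)
    (F0 : 'rV[R]_d -> 'I_2) (F0_classifier : classifier F0)
    (x0 : 'rV[R]_d) (y0 : 'I_2)
    (P : probability 'rV[R]_d R) (p : 'rV[R]_d -> R)
    (P_density : has_density P p) (p_pos : forall x, 0 < p x)
    (c : 'I_2)
    (Q : probability 'rV[R]_d R) (q : 'rV[R]_d -> R)
    (Q_density : has_density Q q)
    (supp_Q : density_support q = [set x - x0 | x in [set x | F0 x = c]])
    (ratio_Q : forall x, density_support q x -> (0 < (q x / p x)%:E < +oo)%E)
    (s : \bar R) (s_ge1 : (1 <= s)%E) :
  r_dsrs s am P Q x0 y0 c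
    (class_prob P F0 x0 ord0 c) (class_prob Q F0 x0 ord0 c)
  = r_tight s am P F0 x0 y0.
Proof.
have mF (F : 'rV[R]_d -> 'I_2) x k :
    classifier F -> measurable [set e | F (x + e) = k].
  by move=> cF; exact: (measurable_preimage_rV_shift _ (cF k)).
have SE : density_support q = [set e | F0 (x0 + e) = c].
  rewrite supp_Q; apply/seteqP; split=> [_ [y Fy <-]|e Fe] /=.
    by rewrite addrC subrK.
  by exists (x0 + e) => //; rewrite addrAC subrr add0r.
(* Equality of the whole vector, not only of entry [c], makes the smoothed classes agree under any
   tie-breaking in [am]. *)
have same F x : classifier F ->
    class_prob P F x0 ord0 c = class_prob P F0 x0 ord0 c ->
    class_prob Q F x0 ord0 c = class_prob Q F0 x0 ord0 c ->
    class_prob P F x = class_prob P F0 x.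
  move=> cF; rewrite !mxE => PF QF.
  have fineK_inj (D : probability 'rV[R]_d R) :
      fine (D [set e | F (x0 + e) = c]) = fine (D [set e | F0 (x0 + e) = c]) ->
      D [set e | F (x0 + e) = c] = D [set e | F0 (x0 + e) = c].
    by move=> DE; rewrite -[LHS]fineK ?DE ?fineK ?fin_num_measure//; exact: mF.
  have := @density_support_determined _ _ P Q p q [set e | F (x0 + e) = c]
    P_density p_pos Q_density.
  rewrite SE => /(_ (mF _ _ _ F0_classifier) (mF _ _ _ cF)).
  move=> /(_ (fineK_inj _ PF) (fineK_inj _ QF)).
  set N := _ `+` _ => N0.
  have mN : measurable N.
    by apply: measurableU; apply: measurableD; exact: mF.
  (* Noise [e] at [x] reaches the same point as noise [x - x0 + e] at [x0], so [M] is the translate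
     of [N] that matters at [x]. *)
  pose M := [set e | N (x - x0 + e)].
  have mM : measurable M by exact: measurable_preimage_rV_shift.
  have PM : P M = 0%E.
    by apply: (has_density_null P_density) => //; rewrite lebesgue_rV_shift.
  have FM e : ~ M e -> F (x + e) = F0 (x + e).
    move=> nM; have shiftE : x0 + (x - x0 + e) = x + e.
      by rewrite addrA (addrC x0) subrK.
    have FcE : F (x + e) = c <-> F0 (x + e) = c.
      by split=> Fc; apply: contrapT => nFc; apply: nM;
        [left|right]; rewrite /= shiftE.
    (* Binary classification enters here: off [M], two predictions that both differ from [c] must
       coincide. *)
    have two (i j k : 'I_2) : i != k -> j != k -> i = j.
      case: i j k => [[|[|//]] ?] [[|[|//]] ?] [[|[|//]] ?] // _ _;
        exact: val_inj.
    have [Fc|/eqP nFc] := pselect (F (x + e) = c).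
      by rewrite Fc (FcE.1 Fc).
    by apply: (two _ _ c) => //; apply: contra_neq nFc => /FcE.
  apply/rowP => k; rewrite !mxE; congr fine.
  have PDM A : measurable A -> P A = P (A `\` M).
    move=> mA; rewrite (measureDI P mA mM)
      [X in (_ + X)%E](_ : _ = 0%E) ?adde0//.
    by apply: subset_measure0 PM => //; exact: measurableI.
  have eq_off_M A B : measurable A -> measurable B -> A `\` M = B `\` M ->
    P A = P B by move=> mA mB AB; rewrite (PDM A)// (PDM B)// AB.
  apply: eq_off_M; [exact: mF|exact: mF|].
  by apply/seteqP; split=> e /= [Fe nMe]; split=> //; rewrite -Fe FM.
(* The sets of admissible radii themselves are equal, under the substitution [x = x0 + delta]. *)
rewrite /r_dsrs /r_tight; congr ereal_sup; apply/seteqP;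
  split=> r [r0 rP]; split=> //.
- move=> delta dr; apply: (rP F0) => //.
  by rewrite addrAC subrr add0r.
- move=> F cF PF QF x xr; rewrite /smoothed same//.
  by have := rP (x - x0); rewrite [x0 + _]addrC subrK; exact.
Qed.
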